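(* Let $\gamma(s)=(X_1,\dots,X_r,Y_1,\dots,Y_r)(s)$, $s\in\mathbb R$, be a Ricci-flat trajectory (as defined in the context). Fix $s^*\in\mathbb R$ and define $t(s)=\int_{-\infty}^{s}\exp\!\big(\int_{s^*}^{\sigma}\mathcal G\big)\,d\sigma$ and $g_i(s)=\frac{\sqrt{d_i}}{Y_i(s)}\exp\!\big(\int_{s^*}^{s}\mathcal G\big)$. Then $t(s)\to+\infty$ as $s\to+\infty$; consequently the corresponding Ricci-flat metric $dt^2+g_1^2d\theta^2+\sum_{i\ge2}g_i^2h_i$ is complete.
   Context: Fix $r\ge2$, $d_1=1$, $\lambda_1=0$, and integers $d_i\ge2$ and reals $\lambda_i>0$ for $i=2,\dots,r$ (dimensions and Einstein constants of Einstein manifolds $(M_i,h_i)$); $n=\sum_i d_i$. Consider the ODE system, with $'=d/ds$ and $\mathcal G=\sum_{j=1}^rX_j^2$: $X_i'=X_i(\mathcal G-1)+\frac{\lambda_iY_i^2}{\sqrt{d_i}}$, $Y_i'=Y_i\big(\mathcal G-\frac{X_i}{\sqrt{d_i}}\big)$, $i=1,\dots,r$. Let $\mathcal L=\sum_iX_i^2+\sum_i\lambda_iY_i^2-1$, $\mathcal H=\sum_i\sqrt{d_i}X_i$, and $P_0$ the point $X_1=Y_1=1$, $X_i=Y_i=0$ ($i\ge2$). A Ricci-flat trajectory is a non-constant solution defined for all $s\in\mathbb R$ with $\gamma(s)\to P_0$ as $s\to-\infty$, contained in $\{\mathcal L=0,\mathcal H=1\}$, and with $Y_i(s)>0$ for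 all $i$ and $s$. *)

(* Defs.v *)
From Stdlib Require Import Reals List.
From Coquelicot Require Import Coquelicot.
Open Scope R_scope.

(* Indices i = 1..r of the paper are encoded as i = 0..r-1 (nat). *)

Definition sumr (r : nat) (f : nat -> R) : R :=
  fold_right Rplus 0 (map f (seq 0 r)).

Definition admissible_data (r : nat) (d : nat -> nat) (lam : nat -> R) : Prop :=
  (2 <= r)%nat /\ d 0%nat = 1%nat /\ lam 0%nat = 0 /\
  (forall i, (1 <= i < r)%nat -> (2 <= d i)%nat /\ 0 < lam i).

Definition Gfun (r : nat) (X : nat -> R -> R) (s : R) : R :=
  sumr r (fun j => (X j s) ^ 2).

Definition Lfun (r : nat) (lam : nat -> R) (X Y : nat -> R -> R) (s : R) : R :=
  sumr r (fun i => (X i s) ^ 2) + sumr r (fun i => lam i * (Y i s) ^ 2) - 1.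

Definition Hfun (r : nat) (d : nat -> nat) (X : nat -> R -> R) (s : R) : R :=
  sumr r (fun i => sqrt (INR (d i)) * X i s).

Definition solves_ODE (r : nat) (d : nat -> nat) (lam : nat -> R)
  (X Y : nat -> R -> R) : Prop :=
  forall i, (i < r)%nat -> forall s : R,
    is_derive (X i) s (X i s * (Gfun r X s - 1)
                       + lam i * (Y i s) ^ 2 / sqrt (INR (d i))) /\
    is_derive (Y i) s (Y i s * (Gfun r X s - X i s / sqrt (INR (d i)))).

Definition P0coord (i : nat) : R := if Nat.eqb i 0 then 1 else 0.

Definition ricci_flat_trajectory (r : nat) (d : nat -> nat) (lam : nat -> R)
  (X Y : nat -> R -> R) : Prop :=
  solves_ODE r d lam X Y /\
  (exists i s1 s2, (i < r)%nat /\ (X i s1 <> X i s2 \/ Y i s1 <> Y i s2)) /\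
  (forall i, (i < r)%nat ->
     is_lim (X i) m_infty (P0coord i) /\ is_lim (Y i) m_infty (P0coord i)) /\
  (forall s, Lfun r lam X Y s = 0 /\ Hfun r d X s = 1) /\
  (forall i s, (i < r)%nat -> 0 < Y i s).

Definition tintegrand (r : nat) (X : nat -> R -> R) (sstar sigma : R) : R :=
  exp (RInt (Gfun r X) sstar sigma).

Definition tfun (r : nat) (X : nat -> R -> R) (sstar s : R) : R :=
  RInt_gen (tintegrand r X sstar) (Rbar_locally m_infty) (at_point s).

(* Main.v *)
Require Import Defs.
From Stdlib Require Import Reals List Lra Lia Classical.
From Coquelicot Require Import Coquelicot.
Open Scope R_scope.

(* Write [E(s) = exp (int_a^s G)], so that [E' = G E].  Near [-oo] the
   trajectory is close to [P0], hence [G >= X_1^2 >= 1/2] there, and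
   [int_x^s0 E <= 2 int_x^s0 G E = 2 (E s0 - E x) <= 2 E s0]: the primitive of
   [E] is nondecreasing and bounded below, so [t] is a convergent improper
   integral.  Towards [+oo], [G >= 0] gives [E >= 1] on [a, +oo), hence
   [t s >= s - a + const]. *)

Lemma sumr_succ (r : nat) (f : nat -> R) :
  sumr (S r) f = f 0%nat + sumr r (fun i => f (S i)).
Proof. unfold sumr; simpl. now rewrite <- seq_shift, map_map. Qed.

Lemma sumr_nonneg (r : nat) (f : nat -> R) :
  (forall i, (i < r)%nat -> 0 <= f i) -> 0 <= sumr r f.
Proof.
  revert f; induction r as [|r IH]; intros f Hf; [unfold sumr; simpl; lra|].
  rewrite sumr_succ. apply Rplus_le_le_0_compat.
  - apply Hf; lia.
  - apply IH; intros i Hi; apply Hf; lia.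
Qed.

Lemma sumr_ge_head (r : nat) (f : nat -> R) :
  (1 <= r)%nat -> (forall i, (i < r)%nat -> 0 <= f i) -> f 0%nat <= sumr r f.
Proof.
  intros Hr Hf. destruct r as [|r]; [lia|]. rewrite sumr_succ.
  assert (0 <= sumr r (fun i => f (S i))) by (apply sumr_nonneg; intros; apply Hf; lia).
  lra.
Qed.

Lemma continuous_sumr (r : nat) (f : nat -> R -> R) (s : R) :
  (forall i, (i < r)%nat -> continuous (f i) s) ->
  continuous (fun x => sumr r (fun i => f i x)) s.
Proof.
  revert f; induction r as [|r IH]; intros f Hf; [apply continuous_const|].
  apply (continuous_ext (fun x => plus (f 0%nat x) (sumr r (fun i => f (S i) x)))).
  { intros x; symmetry; apply sumr_succ. }
  apply (@continuous_plus R_UniformSpace R_AbsRing R_NormedModule).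
  - apply Hf; lia.
  - apply IH; intros i Hi; apply Hf; lia.
Qed.

Lemma nondecreasing_bounded_below_is_lim_m_infty (F : R -> R) (B : R) :
  (forall x y, x <= y -> F x <= F y) -> (forall x, B <= F x) ->
  exists l : R, is_lim F m_infty l.
Proof.
  intros Hmono Hlow.
  destruct (completeness (fun y => exists x, y = - F x)) as [m [Hub Hlub]].
  { exists (- B); intros y [x ->]; specialize (Hlow x); lra. }
  { exists (- F 0), 0; reflexivity. }
  exists (- m). apply is_lim_spec; intros eps.
  assert (Hx0 : exists x0, F x0 < - m + eps).
  { apply NNPP; intros Hn.
    enough (m <= m - eps) by (destruct eps; simpl in *; lra).
    apply Hlub; intros y [x ->].
    destruct (Rlt_or_le (F x) (- m + eps)) as [H|H]; [exfalso; eauto|lra]. }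
  destruct Hx0 as [x0 Hx0]. exists x0; intros x Hx.
  assert (- F x <= m) by (apply Hub; exists x; reflexivity).
  specialize (Hmono x x0 (Rlt_le _ _ Hx)).
  apply Rabs_lt_between; lra.
Qed.

Lemma RInt_ge_length (f : R -> R) (a b : R) :
  a <= b -> ex_RInt f a b -> (forall x, a <= x <= b -> 1 <= f x) ->
  b - a <= RInt f a b.
Proof.
  intros Hab Hf Hge.
  replace (b - a) with (RInt (fun _ => 1) a b)
    by (rewrite RInt_const; unfold scal; simpl; unfold mult; simpl; ring).
  apply RInt_le; auto using ex_RInt_const.
  intros x Hx; apply Hge; lra.
Qed.

Lemma RInt_le_of_log_derivative_ge (f g : R -> R) (c a b : R) :
  a <= b -> 0 < c ->
  (forall x, is_derive f x (g x * f x)) -> (forall x, continuous g x) ->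
  (forall x, a <= x <= b -> 0 < f x /\ c <= g x) ->
  RInt f a b <= f b / c.
Proof.
  intros Hab Hc Hf Hg Hpos.
  assert (Hfc : forall x, continuous f x)
    by (intros x; apply (@ex_derive_continuous R_AbsRing R_NormedModule); eexists; apply Hf).
  assert (Hcont : forall h : R -> R, (forall x, continuous h x) ->
            forall x, continuous (fun y => h y * f y) x)
    by (intros h Hh x; apply (@continuous_mult R_UniformSpace R_AbsRing); auto).
  assert (Hint : RInt (fun y => g y * f y) a b = f b - f a).
  { apply is_RInt_unique, (is_RInt_derive f (fun y => g y * f y)); auto. }
  assert (Hscal : RInt (fun y => c * f y) a b = c * RInt f a b)
    by exact (RInt_scal f a b c
                (@ex_RInt_continuous R_CompleteNormedModule _ _ _ (fun x _ => Hfc x))).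
  assert (Hle : RInt (fun y => c * f y) a b <= RInt (fun y => g y * f y) a b).
  { apply RInt_le; [exact Hab| | |].
    - apply (@ex_RInt_continuous R_CompleteNormedModule); intros x _.
      apply Hcont; intros; apply continuous_const.
    - apply (@ex_RInt_continuous R_CompleteNormedModule); auto.
    - intros x Hx; destruct (Hpos x ltac:(lra)); nra. }
  destruct (Hpos a ltac:(lra)) as [Hfa _].
  apply Rle_div_r; [exact Hc|]. lra.
Qed.

Lemma is_RInt_gen_m_infty_of_primitive (f F : R -> R) (l s : R) :
  (forall x, is_derive F x (f x)) -> (forall x, continuous f x) ->
  is_lim F m_infty l ->
  is_RInt_gen f (Rbar_locally m_infty) (at_point s) (F s - l).
Proof.
  intros HF Hf Hl.
  apply (is_RInt_gen_ext (Derive F)).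
  { apply filter_forall; intros; apply is_derive_unique, HF. }
  apply is_RInt_gen_Derive.
  - apply filter_forall; intros; eexists; apply HF.
  - apply filter_forall; intros.
    apply (continuous_ext f); auto.
    intros; symmetry; apply is_derive_unique, HF.
  - exact Hl.
  - intros P HP; exact (locally_singleton _ _ HP).
Qed.

Lemma is_derive_RInt_continuous (h : R -> R) (b x : R) :
  (forall y, continuous h y) -> is_derive (fun y => RInt h b y) x (h x).
Proof.
  intros Hh. apply is_derive_RInt with b; auto.
  apply filter_forall; intros y.
  apply (@RInt_correct R_CompleteNormedModule), (@ex_RInt_continuous R_CompleteNormedModule).
  auto.
Qed.

Definition exp_primitive (g : R -> R) (a x : R) : R := exp (RInt g a x).

Section ExpPrimitive.

Variables (g : R -> R) (a : R).
Hypothesis g_cont : forall x, continuous g x.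
Hypothesis g_nonneg : forall x, 0 <= g x.

Let E := exp_primitive g a.

Lemma is_derive_exp_primitive x : is_derive E x (g x * E x).
Proof.
  exact (is_derive_comp exp _ x _ _ (is_derive_exp _)
           (is_derive_RInt_continuous g a x g_cont)).
Qed.

Lemma continuous_exp_primitive x : continuous E x.
Proof.
  apply (@ex_derive_continuous R_AbsRing R_NormedModule).
  eexists; apply is_derive_exp_primitive.
Qed.

Lemma exp_primitive_ge_1 x : a <= x -> 1 <= E x.
Proof.
  intros Hx. unfold E, exp_primitive.
  assert (0 <= RInt g a x).
  { apply RInt_ge_0; auto. apply (@ex_RInt_continuous R_CompleteNormedModule); auto. }
  pose proof (exp_ineq1_le (RInt g a x)); lra.
Qed.

Variable c : R.
Hypothesis c_pos : 0 < c.
Hypothesis g_ge_c_at_m_infty : Rbar_locally m_infty (fun x => c <= g x).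

Lemma exp_primitive_is_RInt_gen_m_infty :
  exists l, forall s,
    is_RInt_gen E (Rbar_locally m_infty) (at_point s) (RInt E a s - l).
Proof.
  set (F := fun s => RInt E a s).
  assert (HE : forall x y, ex_RInt E x y).
  { intros; apply (@ex_RInt_continuous R_CompleteNormedModule).
    intros; apply continuous_exp_primitive. }
  assert (HChasles : forall x y, F y = F x + RInt E x y).
  { intros x y; unfold F; rewrite <- (RInt_Chasles E a x y); auto. }
  assert (Hmono : forall x y, x <= y -> F x <= F y).
  { intros x y Hxy; rewrite (HChasles x y).
    enough (0 <= RInt E x y) by lra.
    apply RInt_ge_0; auto; intros; apply Rlt_le, exp_pos. }
  destruct g_ge_c_at_m_infty as [s0 Hs0].
  set (s1 := s0 - 1).
  assert (Hlow : forall x, F s1 - E s1 / c <= F x).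
  { assert (0 < E s1 / c) by (apply Rdiv_lt_0_compat; [apply exp_pos | exact c_pos]).
    intros x; destruct (Rle_or_lt x s1) as [Hx|Hx].
    - rewrite (HChasles x s1).
      enough (RInt E x s1 <= E s1 / c) by lra.
      apply RInt_le_of_log_derivative_ge with g; auto using is_derive_exp_primitive.
      intros y Hy; split; [apply exp_pos | apply Hs0; unfold s1 in Hy; lra].
    - specialize (Hmono s1 x (Rlt_le _ _ Hx)); lra. }
  destruct (nondecreasing_bounded_below_is_lim_m_infty F _ Hmono Hlow) as [l Hl].
  exists l; intros s.
  apply is_RInt_gen_m_infty_of_primitive; auto using continuous_exp_primitive.
  intros x; apply is_derive_RInt_continuous, continuous_exp_primitive.
Qed.

Lemma exp_primitive_RInt_gen_to_p_infty :
  (forall s, ex_RInt_gen E (Rbar_locally m_infty) (at_point s)) /\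
  is_lim (fun s => RInt_gen E (Rbar_locally m_infty) (at_point s)) p_infty p_infty.
Proof.
  destruct exp_primitive_is_RInt_gen_m_infty as [l Hl].
  split; [intros s; eexists; apply Hl|].
  apply (is_lim_le_p_loc (fun s => s - (a + l))).
  - exists a; intros s Hs.
    rewrite (is_RInt_gen_unique _ _ (Hl s)).
    enough (s - a <= RInt E a s) by lra.
    apply RInt_ge_length; [lra| |].
    + apply (@ex_RInt_continuous R_CompleteNormedModule).
      intros; apply continuous_exp_primitive.
    + intros x Hx; apply exp_primitive_ge_1; lra.
  - eapply is_lim_minus; [apply is_lim_id | apply is_lim_const | reflexivity].
Qed.

End ExpPrimitive.

Lemma Gfun_nonneg (r : nat) (X : nat -> R -> R) (s : R) : 0 <= Gfun r X s.
Proof. apply sumr_nonneg; intros; apply pow2_ge_0. Qed.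

Lemma continuous_Gfun (r : nat) (d : nat -> nat) (lam : nat -> R)
  (X Y : nat -> R -> R) (s : R) :
  solves_ODE r d lam X Y -> continuous (Gfun r X) s.
Proof.
  intros Hode. apply (continuous_sumr r (fun j x => X j x ^ 2)); intros j Hj.
  apply (@ex_derive_continuous R_AbsRing R_NormedModule); eexists.
  apply is_derive_pow, (Hode j Hj s).
Qed.

Lemma Gfun_ge_half_at_m_infty (r : nat) (X : nat -> R -> R) :
  (1 <= r)%nat -> is_lim (X 0%nat) m_infty 1 ->
  Rbar_locally m_infty (fun s => 1 / 2 <= Gfun r X s).
Proof.
  intros Hr HX.
  assert (Hnear : Rbar_locally m_infty (fun s => 3 / 4 < X 0%nat s)).
  { apply is_lim_spec in HX.
    assert (Heps : 0 < 1 / 4) by lra.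
    destruct (HX (mkposreal _ Heps)) as [M HM]; exists M; intros s Hs.
    specialize (HM s Hs); simpl in HM; apply Rabs_lt_between in HM; lra. }
  apply (filter_imp (fun s => 3 / 4 < X 0%nat s)); [|exact Hnear].
  intros s Hs.
  pose proof (sumr_ge_head r (fun j => X j s ^ 2) Hr (fun j _ => pow2_ge_0 (X j s))).
  unfold Gfun; simpl in *; nra.
Qed.

Theorem lemma4p1 (r : nat) (d : nat -> nat) (lam : nat -> R)
  (X Y : nat -> R -> R) (sstar : R) :
  admissible_data r d lam ->
  ricci_flat_trajectory r d lam X Y ->
  (forall s : R,
     ex_RInt_gen (tintegrand r X sstar) (Rbar_locally m_infty) (at_point s)) /\
  is_lim (fun s => tfun r X sstar s) p_infty p_infty.
Proof.
  intros [Hr _] [Hode [_ [Hlim _]]].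
  destruct (Hlim 0%nat ltac:(lia)) as [HX0 _].
  apply (exp_primitive_RInt_gen_to_p_infty (Gfun r X) sstar
           (fun s => continuous_Gfun r d lam X Y s Hode) (Gfun_nonneg r X) (1 / 2)).
  - lra.
  - apply Gfun_ge_half_at_m_infty; [lia | exact HX0].
Qed.
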